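(* Let $\boldsymbol{\gamma}:[0,L)\to\mathbb{R}^2$, $\boldsymbol{\gamma}(t)=(x(t),y(t))$, be a smooth regular parameterization (not necessarily by arc length) of a smooth closed plane curve, with $x,y$ extending to smooth $L$-periodic functions and $x'^2+y'^2>0$. Let $\mathbf{n}(t)=\dfrac{(y'(t),-x'(t))}{\sqrt{x'(t)^2+y'(t)^2}}$ be the unit normal, and let $\mathbf{h}(t)=h(t)\,\mathbf{n}(t)$ be a normal perturbation, where $h$ is a smooth real-valued $L$-periodic function. Let $H(\boldsymbol{\gamma})$ be the signed curvature of the parameterization and let $D_\Gamma H(\boldsymbol{\gamma})$ be its Fréchet derivative with respect to the boundary curve. Then $$\left[D_\Gamma H(\boldsymbol{\gamma})\right]\mathbf{h} = -H(\boldsymbol{\gamma})^2\,h+\frac{x'x''+y'y''}{(x'^2+y'^2)^2}\,h'-\frac{1}{x'^2+y'^2}\,h''$$ as functions of $t\in[0,L)$.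
   Context: Primes denote derivatives with respect to the parameter $t$. For a regular parameterization $\boldsymbol{\gamma}=(x,y)$ of a plane curve, the signed curvature is the function of $t$ given by $$H(\boldsymbol{\gamma})=\frac{x'y''-x''y'}{(x'^2+y'^2)^{3/2}}.$$ For a smooth $L$-periodic $\mathbb{R}^2$-valued function $\mathbf{h}$ and small $\epsilon>0$, let $\boldsymbol{\gamma}_\epsilon(t)=\boldsymbol{\gamma}(t)+\epsilon\,\mathbf{h}(t)$. The derivative $D_\Gamma H(\boldsymbol{\gamma})$ is the linear operator, mapping such $\mathbf{h}$ to real-valued functions on $[0,L)$, such that for all such $\mathbf{h}$ $$\lim_{\epsilon\to0}\frac{\left\|H(\boldsymbol{\gamma}_\epsilon)-\left(H(\boldsymbol{\gamma})+\epsilon\,[D_\Gamma H(\boldsymbol{\gamma})]\mathbf{h}\right)\right\|}{\epsilon}=0,$$ where $\|\cdot\|$ is the supremum norm on functions of $t\in[0,L)$. *)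

(* Defs.v *)
From HB Require Import structures.
From mathcomp Require Import all_boot all_order all_algebra.
From mathcomp Require Import all_classical all_reals all_analysis.

Set Implicit Arguments.
Unset Strict Implicit.
Unset Printing Implicit Defensive.

Import Order.TTheory GRing.Theory Num.Theory.
Import numFieldNormedType.Exports.

Local Open Scope ring_scope.
Local Open Scope classical_set_scope.

Section Curvature.
Context {R : realType}.
Implicit Types (f : R -> R) (g k : R -> R * R) (L t : R).

Definition smooth f := forall n t, derivable (derive1n n f) t 1.

Definition smooth_periodic L f := smooth f /\ periodic f L.

Definition smooth_periodic2 L g :=
  smooth_periodic L (fun t => (g t).1) /\ smooth_periodic L (fun t => (g t).2).

Definition regular g :=
  forall t, 0 < derive1 (fun s => (g s).1) t ^+ 2
                + derive1 (fun s => (g s).2) t ^+ 2.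

Definition curvature g t : R :=
  let x s := (g s).1 in
  let y s := (g s).2 in
  (derive1 x t * derive1n 2 y t - derive1n 2 x t * derive1 y t)
  / ((derive1 x t ^+ 2 + derive1 y t ^+ 2) `^ (3%:R / 2%:R)).

Definition unit_normal g t : R * R :=
  let x s := (g s).1 in
  let y s := (g s).2 in
  (Num.sqrt (derive1 x t ^+ 2 + derive1 y t ^+ 2))^-1 *:
    (derive1 y t, - derive1 x t).

(* Valued in the extended reals, so that an unbounded function has norm +oo
   rather than the default value of a real supremum. *)
Definition sup_norm L f : \bar R := ereal_sup [set `|f t|%:E | t in `[0, L[].

(* An operator is a function on all maps R -> R * R with values in R -> R, but
   only its values on smooth L-periodic maps, at the points of [0, L[, are
   constrained. *)
Definition linear_on_periodic L (D : (R -> R * R) -> R -> R) :=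
  forall (a : R) g k, smooth_periodic2 L g -> smooth_periodic2 L k ->
  forall t, 0 <= t < L ->
    D (fun s => a *: g s + k s) t = a * D g t + D k t.

(* The error term [H(g + eps k) - (H(g) + eps D k)], as a function of t. For
   large eps the perturbed curve need not be regular. *)
Definition curvature_error g k (D : (R -> R * R) -> R -> R) (eps : R) t : R :=
  curvature (fun s => g s + eps *: k s) t - (curvature g t + eps * D k t).

Definition is_curvature_derivative L g (D : (R -> R * R) -> R -> R) :=
  linear_on_periodic L D /\
  forall k, smooth_periodic2 L k ->
    (sup_norm L (curvature_error g k D eps) / eps%:E)%E
      @[eps --> (0 : R)^'+] --> 0%E.

End Curvature.

(* Main.v *)
Require Import Defs.
From HB Require Import structures.
From mathcomp Require Import all_boot all_order all_algebra.
From mathcomp Require Import all_classical all_reals all_analysis.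
From mathcomp Require Import ring lra.
Import Order.TTheory GRing.Theory Num.Theory.
Import numFieldNormedType.Exports.
Local Open Scope ring_scope.
Local Open Scope classical_set_scope.

Set Implicit Arguments.
Unset Strict Implicit.

(* Write A for the reciprocal speed (x'^2 + y'^2)^(-1/2), so that the curvature
   is N A^3 with N = x' y'' - x'' y'. If B is the reciprocal speed of the curve
   perturbed by eps, then B^3 - A^3 has an exact first-order expansion in
   B^-2 - A^-2 whose remainder is polynomial in A, B and (A + B)^-1. Hence the
   error of the obvious first-order formula is eps^2 times a polynomial in
   quantities that are bounded uniformly over a period, by compactness and
   because the perturbed speed stays away from 0 for small eps. This gives
   existence; uniqueness holds since two candidates differ at a point by at most
   the sum of the two error quotients. The value at h n follows from
   A' = - (x' x'' + y' y'') A^3 and a polynomial identity modulo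
   A^2 (x'^2 + y'^2) = 1. *)

(** * Derivative rules for functions given pointwise *)

Lemma is_deriveM_pointwise {R : realType} (f g : R -> R) (t a b : R) :
  is_derive t 1 f a -> is_derive t 1 g b ->
  is_derive t 1 (fun s => f s * g s) (a * g t + f t * b).
Proof.
move=> df dg; have H := is_deriveM df dg.
by apply: (is_derive_eq H); rewrite /GRing.scale /= addrC (mulrC (g t)).
Qed.

Lemma is_deriveD_pointwise {R : realType} (f g : R -> R) (t a b : R) :
  is_derive t 1 f a -> is_derive t 1 g b ->
  is_derive t 1 (fun s => f s + g s) (a + b).
Proof. by move=> df dg; exact: is_deriveD. Qed.

Lemma is_derive_scale {R : realType} (f : R -> R) (c t a : R) :
  is_derive t 1 f a -> is_derive t 1 (fun s => c * f s) (c * a).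
Proof. by move=> df; exact: is_deriveZ. Qed.

(** The derivative is written as a polynomial in [f'] and the reciprocal root itself, so that it can
    be differentiated again by the same rule. *)
Lemma is_derive_inv_sqrt {R : realType} (f : R -> R) (t a : R) :
  0 < f t -> is_derive t 1 f a ->
  is_derive t 1 (fun s => (Num.sqrt (f s))^-1)
    (- 2^-1 * (a * (Num.sqrt (f t))^-1 ^+ 3)).
Proof.
move=> f0 df.
have s0 : Num.sqrt (f t) != 0 by rewrite gt_eqF// sqrtr_gt0.
have H := @is_deriveV _ (Num.sqrt \o f) _ _ _ s0
  (is_derive1_comp (is_derive1_sqrt f0) df).
apply: (is_derive_eq H); rewrite /GRing.scale /=; field.
by rewrite s0.
Qed.

Lemma derivable_is_derive {R : realType} (f : R -> R) (t : R) :
  derivable f t 1 -> is_derive t 1 f (derive1 f t).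
Proof. by move=> df; rewrite derive1E; exact: derivableP. Qed.

Lemma is_derive_derive1 {R : realType} (f f' : R -> R) :
  (forall t : R, is_derive t 1 f (f' t)) -> derive1 f = f'.
Proof. by move=> df; apply/funext => t; rewrite derive1E; exact: derive_val. Qed.

(** * Closure properties of smooth functions *)

(* Inductive rather than [forall m, m < n -> _], so that unification does not
   unfold it down to iterated derivatives. *)
Inductive ndiff {R : realType} : nat -> (R -> R) -> Prop :=
| ndiff0 (f : R -> R) : ndiff 0 f
| ndiff_succ n (f : R -> R) :
    (forall t, derivable f t 1) -> ndiff n (derive1 f) -> ndiff n.+1 f.

Lemma ndiffS {R : realType} (n : nat) (f : R -> R) :
  ndiff n.+1 f -> (forall t, derivable f t 1) /\ ndiff n (derive1 f).
Proof.
(* Inversion by hand: the index becomes a variable [m] tied to [n.+1] by an equation, which rules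
   out [ndiff0]. *)
move: {1 3}n.+1 (erefl n.+1) => m + nf; case: nf => // k g dg ng [<-].
by split.
Qed.

Lemma ndiffP {R : realType} (n : nat) (f : R -> R) :
  ndiff n f <-> forall m, (m < n)%N -> forall t, derivable (derive1n m f) t 1.
Proof.
elim: n f => [f|n IH f]; first by split=> // _; exact: ndiff0.
split=> [/ndiffS[df /IH nf] [|m] mn t|nf].
- exact: df.
- by rewrite derive1Sn; exact: nf.
- apply: ndiff_succ => [t|]; first exact: (nf 0%N).
  by apply/IH => m mn t; rewrite -derive1Sn; exact: nf.
Qed.

Lemma smooth_ndiff {R : realType} (f : R -> R) :
  smooth f <-> forall n, ndiff n f.
Proof.
split=> [sf n|sf n t]; first by apply/ndiffP => m _ t; exact: sf.
by have /ndiffP := sf n.+1; exact.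
Qed.

Lemma ndiff_le {R : realType} (m n : nat) (f : R -> R) :
  (m <= n)%N -> ndiff n f -> ndiff m f.
Proof.
by move=> mn /ndiffP nf; apply/ndiffP => k km; apply: nf; exact: leq_trans mn.
Qed.

Lemma is_derive_ndiffS {R : realType} (n : nat) (f f' : R -> R) :
  (forall t : R, is_derive t 1 f (f' t)) -> ndiff n f' -> ndiff n.+1 f.
Proof.
move=> df nf'; apply: ndiff_succ => [t|]; first by case: (df t).
by rewrite (is_derive_derive1 df).
Qed.

Lemma ndiffS_is_derive {R : realType} (n : nat) (f : R -> R) :
  ndiff n.+1 f -> forall t : R, is_derive t 1 f (derive1 f t).
Proof. by case/ndiffS => df _ t; exact: derivable_is_derive. Qed.

Lemma ndiffS_derive1 {R : realType} (n : nat) (f : R -> R) :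
  ndiff n.+1 f -> ndiff n (derive1 f).
Proof. by case/ndiffS. Qed.

Lemma ndiffD {R : realType} (n : nat) (f g : R -> R) :
  ndiff n f -> ndiff n g -> ndiff n (fun s => f s + g s).
Proof.
elim: n f g => [*|n IH f g nf ng]; first exact: ndiff0.
have dfg (t : R) :
    is_derive t 1 (fun s => f s + g s) (derive1 f t + derive1 g t).
  exact: (is_deriveD_pointwise (ndiffS_is_derive nf t) (ndiffS_is_derive ng t)).
apply: (is_derive_ndiffS dfg).
by apply: IH; exact: ndiffS_derive1.
Qed.

Lemma ndiff_scale {R : realType} (n : nat) (c : R) (f : R -> R) :
  ndiff n f -> ndiff n (fun s => c * f s).
Proof.
elim: n f => [*|n IH f nf]; first exact: ndiff0.
have dcf (t : R) : is_derive t 1 (fun s => c * f s) (c * derive1 f t).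
  exact: (is_derive_scale c (ndiffS_is_derive nf t)).
apply: (is_derive_ndiffS dcf).
by apply: IH; exact: ndiffS_derive1.
Qed.

Lemma ndiffM {R : realType} (n : nat) (f g : R -> R) :
  ndiff n f -> ndiff n g -> ndiff n (fun s => f s * g s).
Proof.
elim: n f g => [*|n IH f g nf ng]; first exact: ndiff0.
have dfg (t : R) :
    is_derive t 1 (fun s => f s * g s) (derive1 f t * g t + f t * derive1 g t).
  exact: (is_deriveM_pointwise (ndiffS_is_derive nf t) (ndiffS_is_derive ng t)).
apply: (is_derive_ndiffS dfg).
have [nf' ng'] := (ndiffS_derive1 nf, ndiffS_derive1 ng).
(* The undifferentiated factors of the Leibniz formula are needed at order [n] too. *)
have [nf0 ng0] := (ndiff_le (leqnSn n) nf, ndiff_le (leqnSn n) ng).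
by apply: ndiffD; apply: IH.
Qed.

(** Bootstrapping: the derivative of r = f^(-1/2) is - f' r^3 / 2, so regularity of order n for r
    and f' gives order n + 1 for r. *)
Lemma ndiff_inv_sqrt {R : realType} (n : nat) (f : R -> R) :
  (forall t, 0 < f t) -> ndiff n f -> ndiff n (fun s => (Num.sqrt (f s))^-1).
Proof.
move=> f0; elim: n => [*|n IH nf]; first exact: ndiff0.
have nr : ndiff n (fun s => (Num.sqrt (f s))^-1).
  exact/IH/(ndiff_le (leqnSn n) nf).
have dr (t : R) : is_derive t 1 (fun s => (Num.sqrt (f s))^-1)
    (- 2^-1 * (derive1 f t * (Num.sqrt (f t))^-1 ^+ 3)).
  exact: (is_derive_inv_sqrt (f0 t) (ndiffS_is_derive nf t)).
apply: (is_derive_ndiffS dr).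
apply/ndiff_scale/ndiffM; first exact: ndiffS_derive1.
rewrite (_ : (fun s => _) = (fun s =>
  (Num.sqrt (f s))^-1 * ((Num.sqrt (f s))^-1 * (Num.sqrt (f s))^-1))).
  by apply: ndiffM => //; exact: ndiffM.
by apply/funext => s; rewrite !exprS expr0 mulr1.
Qed.

Lemma smoothD {R : realType} (f g : R -> R) :
  smooth f -> smooth g -> smooth (fun s => f s + g s).
Proof.
by move=> /smooth_ndiff ? /smooth_ndiff ?; apply/smooth_ndiff => n; exact: ndiffD.
Qed.

Lemma smooth_scale {R : realType} (c : R) (f : R -> R) :
  smooth f -> smooth (fun s => c * f s).
Proof.
by move=> /smooth_ndiff ?; apply/smooth_ndiff => n; exact: ndiff_scale.
Qed.

Lemma smoothM {R : realType} (f g : R -> R) :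
  smooth f -> smooth g -> smooth (fun s => f s * g s).
Proof.
by move=> /smooth_ndiff ? /smooth_ndiff ?; apply/smooth_ndiff => n; exact: ndiffM.
Qed.

Lemma smooth_sqr {R : realType} (f : R -> R) :
  smooth f -> smooth (fun s => f s ^+ 2).
Proof. by move=> sf; under eq_fun do rewrite expr2; exact: smoothM. Qed.

Lemma smooth_inv_sqrt {R : realType} (f : R -> R) :
  (forall t, 0 < f t) -> smooth f -> smooth (fun s => (Num.sqrt (f s))^-1).
Proof.
by move=> f0 /smooth_ndiff ?; apply/smooth_ndiff => n; exact: ndiff_inv_sqrt.
Qed.

Lemma smooth_derive1 {R : realType} (f : R -> R) : smooth f -> smooth (derive1 f).
Proof. by move=> sf n t; rewrite -derive1Sn; exact: sf. Qed.

Lemma smooth_is_derive {R : realType} (f : R -> R) (t : R) :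
  smooth f -> is_derive t 1 f (derive1 f t).
Proof. by move=> sf; exact/derivable_is_derive/(sf 0%N). Qed.

Lemma smooth_continuous {R : realType} (f : R -> R) : smooth f -> continuous f.
Proof.
move=> sf t; apply: differentiable_continuous; apply/derivable1_diffP.
exact: (sf 0%N).
Qed.

(** The difference quotients at t + L and at t are the same function of the increment. *)
Lemma derive1_periodic {R : realType} (L : R) (f : R -> R) :
  periodic f L -> periodic (derive1 f) L.
Proof.
move=> pf t; rewrite /derive1; congr (lim _).
by under eq_fun do rewrite addrA !pf.
Qed.

Lemma derive1_scaleD {R : realType} (f g : R -> R) (c : R) :
  smooth f -> smooth g ->
  derive1 (fun s => c * f s + g s) = (fun s => c * derive1 f s + derive1 g s).
Proof.
move=> sf sg; apply: is_derive_derive1 => t; apply: is_deriveD_pointwise.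
  exact/is_derive_scale/smooth_is_derive.
exact: smooth_is_derive.
Qed.

(** * Calculus of bounded functions *)

(** The domain is an arbitrary type so that bounds can be taken over pairs (e, t), uniformly in the
    size of the perturbation and the parameter. *)
Definition bounded_on {R : realType} {T : Type} (P : T -> Prop) (f : T -> R) :=
  exists K : R, forall x, P x -> `|f x| <= K.

Lemma bounded_on_cst {R : realType} {T : Type} (P : T -> Prop) (c : R) :
  bounded_on P (fun=> c).
Proof. by exists `|c|. Qed.

Lemma bounded_onD {R : realType} {T : Type} (P : T -> Prop) (f g : T -> R) :
  bounded_on P f -> bounded_on P g -> bounded_on P (fun x => f x + g x).
Proof.
move=> [K fK] [M gM]; exists (K + M) => x Px.
by rewrite (le_trans (ler_normD _ _))// lerD ?fK ?gM.
Qed.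

Lemma bounded_onN {R : realType} {T : Type} (P : T -> Prop) (f : T -> R) :
  bounded_on P f -> bounded_on P (fun x => - f x).
Proof. by move=> [K fK]; exists K => x Px; rewrite normrN fK. Qed.

Lemma bounded_onM {R : realType} {T : Type} (P : T -> Prop) (f g : T -> R) :
  bounded_on P f -> bounded_on P g -> bounded_on P (fun x => f x * g x).
Proof.
move=> [K fK] [M gM]; exists (K * M) => x Px.
by rewrite normrM ler_pM ?fK ?gM.
Qed.

Lemma bounded_onX {R : realType} {T : Type} (P : T -> Prop) (f : T -> R) n :
  bounded_on P f -> bounded_on P (fun x => f x ^+ n).
Proof.
move=> [K fK]; exists (K ^+ n) => x Px.
by rewrite normrX lerXn2r ?nnegrE ?(le_trans _ (fK x Px)) ?fK.
Qed.

Ltac bounded_on_poly :=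
  repeat first [assumption | apply: bounded_onN | apply: bounded_onD
    | apply: bounded_onX | apply: bounded_onM | apply: bounded_on_cst].

Lemma bounded_on_inv_sqrt {R : realType} {T : Type} (P : T -> Prop) (c : R)
    (f : T -> R) :
  0 < c -> (forall x, P x -> c <= f x) ->
  bounded_on P (fun x => (Num.sqrt (f x))^-1).
Proof.
move=> c0 cf; exists (Num.sqrt c)^-1 => x Px.
have fx0 : 0 < f x := lt_le_trans c0 (cf x Px).
rewrite ger0_norm ?invr_ge0 ?sqrtr_ge0//.
by rewrite lef_pV2 ?posrE ?sqrtr_gt0//; exact/ler_wsqrtr/cf.
Qed.

(** * First-order expansion of the curvature, with exact remainder *)

(* [p q r s] stand for x', y', x'', y'', [u v a b] for the same derivatives of
   the perturbation, and [A] for the reciprocal speed, so that the curvature is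
   [(p * s - r * q) * A ^+ 3]. *)
Definition curvature_diff {R : realType} (p q r s u v a b A : R) : R :=
  (p * b + u * s - r * v - a * q) * A ^+ 3
  - 3 * ((p * s - r * q) * (p * u + q * v)) * A ^+ 5.

(* [B] is the reciprocal speed of the perturbed curve, and [rho] is
   [(A + B)^-1]: in these terms the remainder is a polynomial. *)
Definition taylor_coef {R : realType} (p q r s u v a b e A B rho : R) : R :=
  let N0 := p * s - r * q in
  let N1 := p * b + u * s - r * v - a * q in
  let N2 := u * b - a * v in
  let delta := 2 * (p * u + q * v) + e * (u ^+ 2 + v ^+ 2) in
  let E := delta ^+ 2 * A ^+ 4 * B ^+ 2 * rho ^+ 2
           * (B ^+ 3 + 2 * A * B ^+ 2 + 3 * A ^+ 2 * B + 3 / 2 * A ^+ 3) in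
  N0 * (E - 3 / 2 * (u ^+ 2 + v ^+ 2) * A ^+ 5)
  + N1 * (e * E - 3 / 2 * delta * A ^+ 5) + N2 * B ^+ 3.

Lemma curvature_diff_linear {R : realType}
    (c p q r s u v a b u' v' a' b' A : R) :
  curvature_diff p q r s (c * u + u') (c * v + v') (c * a + a') (c * b + b') A
  = c * curvature_diff p q r s u v a b A + curvature_diff p q r s u' v' a' b' A.
Proof. by rewrite /curvature_diff; ring. Qed.

(** The factor of [e] in the increment is the [delta] of [taylor_coef]. *)
Lemma speed_perturbation {R : realType} (p q u v e : R) :
  (p + e * u) ^+ 2 + (q + e * v) ^+ 2 =
  p ^+ 2 + q ^+ 2 + e * (2 * (p * u + q * v) + e * (u ^+ 2 + v ^+ 2)).
Proof. by ring. Qed.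

(* [d] is the increment of [w] from [A ^- 2] to [B ^- 2]: this is the first-order
   expansion of [w `^ (- 3 / 2)] with its remainder. *)
Lemma inv_cube_taylor {R : realType} (A B : R) : 0 < A -> 0 < B ->
  let d := B ^- 2 - A ^- 2 in
  B ^+ 3 = A ^+ 3 - 3 / 2 * d * A ^+ 5
    + d ^+ 2 * A ^+ 4 * B ^+ 2 * (A + B)^-1 ^+ 2
      * (B ^+ 3 + 2 * A * B ^+ 2 + 3 * A ^+ 2 * B + 3 / 2 * A ^+ 3).
Proof.
(* The remainder times B^2 is B^5 - 5/2 A^3 B^2 + 3/2 A^5, which is (A - B)^2 times the cubic
   factor; and (A - B)^2 = d^2 A^4 B^4 (A + B)^-2. *)
move=> A0 B0 d; rewrite /d; field.
by rewrite !gt_eqF ?addr_gt0.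
Qed.

(** The perturbed numerator is exactly N0 + e N1 + e^2 N2; it is multiplied by the expansion of B^3
    with d = e [delta], and the terms of order 0 and 1 in e cancel. *)
Lemma curvature_taylor {R : realType} (p q r s u v a b e A B : R) :
  0 < A -> 0 < B -> p ^+ 2 + q ^+ 2 = A ^- 2 ->
  (p + e * u) ^+ 2 + (q + e * v) ^+ 2 = B ^- 2 ->
  ((p + e * u) * (s + e * b) - (r + e * a) * (q + e * v)) * B ^+ 3
  - ((p * s - r * q) * A ^+ 3 + e * curvature_diff p q r s u v a b A)
  = e ^+ 2 * taylor_coef p q r s u v a b e A B (A + B)^-1.
Proof.
move=> A0 B0 hA hB; rewrite /taylor_coef /curvature_diff.
set delta := 2 * _ + _; set rho := (A + B)^-1.
have hd : B ^- 2 - A ^- 2 = e * delta.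
  by rewrite -hA -hB speed_perturbation addrC addKr.
have /= := inv_cube_taylor A0 B0; rewrite hd -/rho.
(* [B ^+ 3] also occurs inside the remainder, which is therefore kept opaque while the other
   occurrences are expanded. *)
set C := B ^+ 3; set E := C + _ + _ + _ => hC.
have {}hC : C = A ^+ 3 - 3 / 2 * (e * delta) * A ^+ 5
  + e ^+ 2 * (delta ^+ 2 * A ^+ 4 * B ^+ 2 * rho ^+ 2 * E).
  by rewrite {1}hC; ring.
move: hC; set E' := delta ^+ 2 * _ * _ * _ * _ => ->.
by rewrite /delta; field.
Qed.

(** * Bounds from polynomial form and from compactness *)

Lemma bounded_on_speed_perturbation {R : realType} {T : Type} (P : T -> Prop)
    (p q u v e : T -> R) :
  bounded_on P p -> bounded_on P q -> bounded_on P u -> bounded_on P v ->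
  bounded_on P e ->
  bounded_on P (fun x => 2 * (p x * u x + q x * v x)
                         + e x * (u x ^+ 2 + v x ^+ 2)).
Proof. by move=> *; bounded_on_poly. Qed.

Lemma bounded_on_taylor_coef {R : realType} {T : Type} (P : T -> Prop)
    (p q r s u v a b e A B rho : T -> R) :
  bounded_on P p -> bounded_on P q -> bounded_on P r -> bounded_on P s ->
  bounded_on P u -> bounded_on P v -> bounded_on P a -> bounded_on P b ->
  bounded_on P e -> bounded_on P A -> bounded_on P B -> bounded_on P rho ->
  bounded_on P (fun x => taylor_coef (p x) (q x) (r x) (s x) (u x) (v x) (a x)
                           (b x) (e x) (A x) (B x) (rho x)).
Proof. by move=> *; rewrite /taylor_coef; bounded_on_poly. Qed.

Lemma continuous_bounded_on {R : realType} (a b : R) (f : R -> R) :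
  a <= b -> continuous f -> bounded_on (fun t => a <= t <= b) f.
Proof.
move=> ab cf.
have cnf : continuous (fun t => `|f t|).
  by move=> t; apply: continuous_comp (cf t) _; exact: norm_continuous.
have [c _ fc] := EVT_max ab (continuous_subspaceT cnf).
by exists `|f c| => t tab; apply: fc; rewrite in_itv.
Qed.

Lemma continuous_lower_bound {R : realType} (a b : R) (f : R -> R) :
  a <= b -> continuous f -> (forall t, 0 < f t) ->
  exists2 c, 0 < c & forall t, a <= t <= b -> c <= f t.
Proof.
move=> ab cf f0; have [c _ fc] := EVT_min ab (continuous_subspaceT cf).
by exists (f c) => // t tab; apply: fc; rewrite in_itv.
Qed.

(** * Limits of supremum norm quotients *)

Lemma sup_norm_ge {R : realType} (L t : R) (f : R -> R) :
  0 <= t < L -> (`|f t|%:E <= sup_norm L f)%E.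
Proof. by move=> tL; apply: ereal_sup_ubound; exists t => //=; rewrite in_itv. Qed.

Lemma sup_norm_le {R : realType} (L K : R) (f : R -> R) :
  (forall t, 0 <= t < L -> `|f t| <= K) -> (sup_norm L f <= K%:E)%E.
Proof.
move=> fK; apply: ge_ereal_sup => x [t /=]; rewrite in_itv/= => tL <-.
by rewrite lee_fin fK.
Qed.

(** For 0 < e < d the quotient is squeezed between 0 and K e. *)
Lemma sup_norm_quadratic_cvg0 {R : realType} (L K d : R) (F : R -> R -> R) :
  0 < L -> 0 < d ->
  (forall e t, 0 < e < d -> 0 <= t < L -> `|F e t| <= K * e ^+ 2) ->
  (sup_norm L (F e) / e%:E)%E @[e --> (0 : R)^'+] --> 0%E.
Proof.
move=> L0 d0 FK.
apply: (@squeeze_cvge _ _ _ _ (fun=> 0%E) _ (fun e => (K * e)%:E)).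
- near=> e.
  have e0 : 0 < e by near: e; exact: nbhs_right_gt.
  have ed : e < d by near: e; exact: nbhs_right_lt.
  rewrite inver gt_eqF//; apply/andP; split.
    apply: mule_ge0; last by rewrite lee_fin invr_ge0 ltW.
    (* The point 0 of [0, L) witnesses nonnegativity; over an empty set the supremum would be
       -oo. *)
    by apply: le_trans (sup_norm_ge _ (_ : 0 <= 0 < L)); rewrite ?lee_fin// lexx.
  rewrite lee_pdivrMr// -EFinM -mulrA -expr2.
  by apply: sup_norm_le => t tL; apply: FK; rewrite ?e0.
- exact: cvg_cst.
- apply: cvg_EFin; first by near=> e.
  apply: cvg_at_right_filter; rewrite -[X in _ --> X](mulr0 K).
  by apply: cvgM; [exact: cvg_cst|exact: cvg_id].
Unshelve. all: by end_near.
Qed.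

(** For every e > 0, |c| = |F e t - G e t| / e is at most the sum of the two quotients, which tends
    to 0 while |c| does not depend on e. *)
Lemma sup_norm_cvg0_unique {R : realType} (L t c : R) (F G : R -> R -> R) :
  0 <= t < L -> (forall e, F e t - G e t = e * c) ->
  (sup_norm L (F e) / e%:E)%E @[e --> (0 : R)^'+] --> 0%E ->
  (sup_norm L (G e) / e%:E)%E @[e --> (0 : R)^'+] --> 0%E ->
  c = 0.
Proof.
move=> tL FG F0 G0; apply/eqP; rewrite -normr_le0 -lee_fin.
have FG0 : (sup_norm L (F e) / e%:E + sup_norm L (G e) / e%:E)%E
    @[e --> (0 : R)^'+] --> 0%E.
  by rewrite -[X in _ --> X]adde0; exact: cvgeD.
apply: (cvge_to_ge FG0); near=> e.
have e0 : 0 < e by near: e; exact: nbhs_right_gt.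
have -> : `|c|%:E = (`|F e t - G e t|%:E * (e^-1)%:E)%E.
  by rewrite FG -EFinM normrM gtr0_norm// mulrAC mulfV ?gt_eqF// mul1r.
rewrite inver gt_eqF//.
apply: (@le_trans _ _ (`|F e t|%:E * (e^-1)%:E + `|G e t|%:E * (e^-1)%:E)%E).
  by rewrite -!EFinM -EFinD lee_fin -mulrDl ler_pM2r ?invr_gt0// ler_normB.
by apply: leeD; apply: lee_wpmul2r; rewrite ?lee_fin ?invr_ge0 ?(ltW e0)//;
  exact: sup_norm_ge.
Unshelve. all: by end_near.
Qed.

(** * Existence and uniqueness of the derivative of the curvature *)

(** Supplies what [curvature_taylor] assumes of [A] and [B]. *)
Lemma inv_sqrt_sqr {R : realType} (w : R) :
  0 < w -> 0 < (Num.sqrt w)^-1 /\ (Num.sqrt w)^-1 ^- 2 = w.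
Proof.
by move=> w0; rewrite invr_gt0 sqrtr_gt0 w0 exprVn invrK sqr_sqrtr// ltW.
Qed.

Lemma div_powR_3_2 {R : realType} (n w : R) :
  0 < w -> n / w `^ (3%:R / 2%:R) = n * (Num.sqrt w)^-1 ^+ 3.
Proof.
move=> w0; rewrite powRrM powR12_sqrt ?powR_ge0// exprVn; congr (_ * _^-1).
rewrite powR_mulrn ?(ltW w0)// -[in LHS](sqr_sqrtr (ltW w0)) exprAC sqrtr_sqr.
by rewrite ger0_norm// exprn_ge0// sqrtr_ge0.
Qed.

(** The candidate operator in an arbitrary direction [k]: the e-derivative at e = 0 of the curvature
    of g + e k. *)
Definition curvature_derivative {R : realType} (g k : R -> R * R) (t : R) : R :=
  let x s := (g s).1 in
  let y s := (g s).2 in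
  let u s := (k s).1 in
  let v s := (k s).2 in
  curvature_diff (derive1 x t) (derive1 y t) (derive1n 2 x t) (derive1n 2 y t)
    (derive1 u t) (derive1 v t) (derive1n 2 u t) (derive1n 2 v t)
    (Num.sqrt (derive1 x t ^+ 2 + derive1 y t ^+ 2))^-1.

Lemma curvature_derivative_linear {R : realType} (L : R) (g : R -> R * R) :
  linear_on_periodic L (curvature_derivative g).
Proof.
move=> c k1 k2 [[s1 _] [s2 _]] [[s3 _] [s4 _]] t _.
have du : derive1 (fun s => (c *: k1 s + k2 s).1) =
  (fun s => c * derive1 (fun s => (k1 s).1) s + derive1 (fun s => (k2 s).1) s)
  := derive1_scaleD c s1 s3.
have dv : derive1 (fun s => (c *: k1 s + k2 s).2) =
  (fun s => c * derive1 (fun s => (k1 s).2) s + derive1 (fun s => (k2 s).2) s)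
  := derive1_scaleD c s2 s4.
have ddu := derive1_scaleD c (smooth_derive1 s1) (smooth_derive1 s3).
have ddv := derive1_scaleD c (smooth_derive1 s2) (smooth_derive1 s4).
rewrite /curvature_derivative /= du dv ddu ddv; exact: curvature_diff_linear.
Qed.

Lemma derive1_addZ {R : realType} (f g : R -> R) (c : R) :
  smooth f -> smooth g ->
  derive1 (fun s => f s + c * g s) = (fun s => derive1 f s + c * derive1 g s).
Proof.
move=> sf sg; under eq_fun do rewrite addrC.
by rewrite derive1_scaleD//; under eq_fun do rewrite addrC.
Qed.

Lemma curvature_error_bound {R : realType} (L : R) (g k : R -> R * R) :
  0 < L -> smooth (fun t => (g t).1) -> smooth (fun t => (g t).2) ->
  regular g -> smooth (fun t => (k t).1) -> smooth (fun t => (k t).2) ->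
  exists K d, 0 < d /\ forall e t, 0 < e < d -> 0 <= t < L ->
    `|curvature_error g k (curvature_derivative g) e t| <= K * e ^+ 2.
Proof.
move=> L0 sx sy rg su sv.
pose x s := (g s).1; pose y s := (g s).2.
pose u s := (k s).1; pose v s := (k s).2.
pose w t := derive1 x t ^+ 2 + derive1 y t ^+ 2.
pose we (z : R * R) := (derive1 x z.2 + z.1 * derive1 u z.2) ^+ 2
  + (derive1 y z.2 + z.1 * derive1 v z.2) ^+ 2.
pose delta (z : R * R) :=
  2 * (derive1 x z.2 * derive1 u z.2 + derive1 y z.2 * derive1 v z.2)
  + z.1 * (derive1 u z.2 ^+ 2 + derive1 v z.2 ^+ 2).
(* A point z is a pair (e, t); bounds over [P d] hold uniformly in both. *)
pose P d (z : R * R) := 0 < z.1 < d /\ 0 <= z.2 < L.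
have bE d : bounded_on (P d) (fun z => z.1).
  by exists d => z [/andP[z0 zd] _]; rewrite gtr0_norm// ltW.
have bS d f : smooth f -> bounded_on (P d) (fun z => f z.2).
  move=> /smooth_continuous cf.
  have [K fK] := continuous_bounded_on (ltW L0) cf.
  by exists K => z [_ /andP[z0 /ltW zL]]; apply: fK; rewrite z0.
have b1 d f : smooth f -> bounded_on (P d) (fun z => derive1 f z.2).
  by move=> sf; exact/bS/smooth_derive1.
have b2 d f : smooth f -> bounded_on (P d) (fun z => derive1n 2 f z.2).
  by move=> sf; exact/bS/smooth_derive1/smooth_derive1.
have sw : smooth w := smoothD (smooth_sqr (smooth_derive1 sx))
  (smooth_sqr (smooth_derive1 sy)).
have [c c0 cw] := continuous_lower_bound (ltW L0) (smooth_continuous sw) rg.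
(* [delta] is bounded over e < 1 first, since [d] is chosen in terms of this bound. *)
have [K deltaK] : bounded_on (P 1) delta := bounded_on_speed_perturbation
  (b1 1 x sx) (b1 1 y sy) (b1 1 u su) (b1 1 v sv) (bE 1).
have K0 : 0 < 2 * (`|K| + 1) by rewrite mulr_gt0// ltr_wpDl.
(* For e < d the term e [delta] has size at most c / 2, so the perturbed squared speed stays above c
   / 2. Using |K| + 1 keeps the divisor positive. *)
pose d := Num.min 1 (c / (2 * (`|K| + 1))).
have wec z : P d z -> c / 2 <= we z.
  move=> [/andP[z0]]; rewrite lt_min => /andP[z1 zd] zL.
  have -> : we z = w z.2 + z.1 * delta z by exact: speed_perturbation.
  have wz : c <= w z.2 by case/andP: zL => ? /ltW ?; apply: cw; apply/andP.
  have dz : `|delta z| <= `|K| + 1.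
    rewrite (le_trans (deltaK _ _))//; first by split => //; rewrite z0.
    by rewrite (le_trans (ler_norm _))// lerDl.
  have zd2 : z.1 * `|delta z| <= c / 2.
    rewrite (le_trans (ler_wpM2l (ltW z0) dz))//.
    by move: zd; rewrite ltr_pdivlMr// => /ltW; lra.
  have : - (z.1 * `|delta z|) <= z.1 * delta z.
    by rewrite -mulrN ler_wpM2l ?(ltW z0)// lerNl -normrN ler_norm.
  lra.
have we0 z : P d z -> 0 < we z.
  by move=> Pz; rewrite (lt_le_trans _ (wec _ Pz))// divr_gt0.
pose A (z : R * R) := (Num.sqrt (w z.2))^-1.
pose B (z : R * R) := (Num.sqrt (we z))^-1.
have bA : bounded_on (P d) A.
  apply: (bounded_on_inv_sqrt c0) => z [_ /andP[? /ltW ?]].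
  by apply: cw; apply/andP.
have bB : bounded_on (P d) B.
  by apply: bounded_on_inv_sqrt wec; rewrite divr_gt0.
(* As w = A^-2, one has (A + B)^-1 <= A^-1 = A w, a product of bounded functions. *)
have brho : bounded_on (P d) (fun z => (A z + B z)^-1).
  have [M AM] : bounded_on (P d) (fun z => A z * w z.2).
    by apply: bounded_onM => //; exact: bS.
  exists M => z Pz; apply: le_trans (AM z Pz).
  have [A0 Aw] := inv_sqrt_sqr (rg z.2).
  have [B0 _] := inv_sqrt_sqr (we0 _ Pz).
  rewrite -/(w z.2) -/(A z) in A0 Aw; rewrite -/(B z) in B0.
  rewrite -[in w _]Aw expr2 invfM mulrA mulfV ?gt_eqF// mul1r.
  rewrite !ger0_norm ?invr_ge0 ?addr_ge0 ?(ltW A0) ?(ltW B0)//.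
  by rewrite lef_pV2 ?posrE ?addr_gt0// lerDl ltW.
have [M QM] := bounded_on_taylor_coef (b1 d x sx) (b1 d y sy) (b2 d x sx)
  (b2 d y sy) (b1 d u su) (b1 d v sv) (b2 d u su) (b2 d v sv) (bE d) bA bB brho.
exists M, d; split; first by rewrite lt_min ltr01 divr_gt0.
move=> e t ed tL; have Pz : P d (e, t) by [].
suff -> : curvature_error g k (curvature_derivative g) e t =
    e ^+ 2 * taylor_coef (derive1 x t) (derive1 y t) (derive1n 2 x t)
      (derive1n 2 y t) (derive1 u t) (derive1 v t) (derive1n 2 u t)
      (derive1n 2 v t) e (A (e, t)) (B (e, t)) (A (e, t) + B (e, t))^-1.
  rewrite normrM ger0_norm ?sqr_ge0// mulrC ler_wpM2r ?sqr_ge0//.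
  exact: (QM (e, t) Pz).
have [A0 Aw] := inv_sqrt_sqr (rg t); have [B0 Bw] := inv_sqrt_sqr (we0 _ Pz).
rewrite -(curvature_taylor _ _ _ _ A0 B0 (esym Aw) (esym Bw)).
rewrite /curvature_error /curvature /=.
have dx : derive1 (fun s => (g s).1 + e *: (k s).1) =
  (fun s => derive1 x s + e * derive1 u s) := derive1_addZ e sx su.
have dy : derive1 (fun s => (g s).2 + e *: (k s).2) =
  (fun s => derive1 y s + e * derive1 v s) := derive1_addZ e sy sv.
have ddx := derive1_addZ e (smooth_derive1 sx) (smooth_derive1 su).
have ddy := derive1_addZ e (smooth_derive1 sy) (smooth_derive1 sv).
rewrite dx dy ddx ddy.
by rewrite !div_powR_3_2//; exact: (we0 _ Pz).
Qed.

Lemma is_curvature_derivative_exists {R : realType} (L : R) (g : R -> R * R) :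
  0 < L -> smooth_periodic2 L g -> regular g ->
  is_curvature_derivative L g (curvature_derivative g).
Proof.
move=> L0 [[sx _] [sy _]] rg; split; first exact: curvature_derivative_linear.
move=> k [[su _] [sv _]].
have [K [d [d0 errK]]] := curvature_error_bound L0 sx sy rg su sv.
exact: sup_norm_quadratic_cvg0 errK.
Qed.

Lemma is_curvature_derivative_unique {R : realType} (L t : R)
    (g k : R -> R * R) (D1 D2 : (R -> R * R) -> R -> R) :
  is_curvature_derivative L g D1 -> is_curvature_derivative L g D2 ->
  smooth_periodic2 L k -> 0 <= t < L -> D1 k t = D2 k t.
Proof.
(* The curvature terms of the two errors cancel, leaving e (D2 k t - D1 k t). *)
move=> [_ D1k] [_ D2k] sk tL; apply/esym/eqP; rewrite -subr_eq0; apply/eqP.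
apply: (sup_norm_cvg0_unique tL _ (D1k k sk) (D2k k sk)) => e.
rewrite /curvature_error; move: (curvature _ t) (curvature _ t) (D1 k t) (D2 k t).
by move=> ? ? ? ?; ring.
Qed.

(** * Evaluation on a normal perturbation *)

Lemma derive1M_smooth {R : realType} (f g : R -> R) :
  smooth f -> smooth g ->
  derive1 (fun s => f s * g s) = (fun s => derive1 f s * g s + f s * derive1 g s).
Proof.
move=> sf sg; apply: is_derive_derive1 => t.
exact: (is_deriveM_pointwise (smooth_is_derive t sf) (smooth_is_derive t sg)).
Qed.

Lemma derive1n2M_smooth {R : realType} (f g : R -> R) (t : R) :
  smooth f -> smooth g ->
  derive1n 2 (fun s => f s * g s) t =
  derive1n 2 f t * g t + 2 * (derive1 f t * derive1 g t) + f t * derive1n 2 g t.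
Proof.
move=> sf sg; have [sf' sg'] := (smooth_derive1 sf, smooth_derive1 sg).
rewrite /= derive1M_smooth//.
have dd := is_deriveD_pointwise
  (is_deriveM_pointwise (smooth_is_derive t sf') (smooth_is_derive t sg))
  (is_deriveM_pointwise (smooth_is_derive t sf) (smooth_is_derive t sg')).
rewrite [LHS]derive1E (@derive_val _ _ _ _ _ _ _ dd).
by rewrite -addrA addrA mulr2n mulrDl mul1r !addrA.
Qed.

Lemma derive1_inv_sqrt_speed {R : realType} (p q : R -> R) :
  smooth p -> smooth q -> (forall t, 0 < p t ^+ 2 + q t ^+ 2) ->
  let A s := (Num.sqrt (p s ^+ 2 + q s ^+ 2))^-1 in
  derive1 A = (fun s => - ((p s * derive1 p s + q s * derive1 q s) * A s ^+ 3)).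
Proof.
move=> sp sq pq A; apply: is_derive_derive1 => t.
have dw : is_derive t 1 (fun s => p s ^+ 2 + q s ^+ 2)
    (derive1 p t * p t + p t * derive1 p t + (derive1 q t * q t + q t * derive1 q t)).
  have dp := is_deriveM_pointwise (smooth_is_derive t sp) (smooth_is_derive t sp).
  have dq := is_deriveM_pointwise (smooth_is_derive t sq) (smooth_is_derive t sq).
  exact: is_deriveD_pointwise.
have dA := @is_derive_inv_sqrt R (fun s => p s ^+ 2 + q s ^+ 2) _ _ (pq t) dw.
apply: (is_derive_eq dA).
rewrite -/(A t); move: (derive1 p t) (derive1 q t) (A t) (p t) (q t) => *.
by field.
Qed.

(** Differentiates A' = - B A^3 once more; substituting A' again in the derivative of A^3 gives the
    term 3 B^2 A^5. *)
Lemma derive1n2_inv_sqrt_speed {R : realType} (p q : R -> R) (t : R) :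
  smooth p -> smooth q -> (forall t, 0 < p t ^+ 2 + q t ^+ 2) ->
  let A s := (Num.sqrt (p s ^+ 2 + q s ^+ 2))^-1 in
  let B := p t * derive1 p t + q t * derive1 q t in
  derive1n 2 A t = 3 * B ^+ 2 * A t ^+ 5
    - (derive1 p t ^+ 2 + derive1 q t ^+ 2 + p t * derive1n 2 p t
       + q t * derive1n 2 q t) * A t ^+ 3.
Proof.
move=> sp sq pq A B; have [sp' sq'] := (smooth_derive1 sp, smooth_derive1 sq).
have sA : smooth A := @smooth_inv_sqrt R _ pq (smoothD (smooth_sqr sp) (smooth_sqr sq)).
have dA := smooth_is_derive t sA.
have dB := is_deriveD_pointwise
  (is_deriveM_pointwise (smooth_is_derive t sp) (smooth_is_derive t sp'))
  (is_deriveM_pointwise (smooth_is_derive t sq) (smooth_is_derive t sq')).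
have dA3 := is_deriveM_pointwise dA (is_deriveM_pointwise dA dA).
have dd := is_derive_scale (-1) (is_deriveM_pointwise dB dA3).
rewrite /= [derive1 A]derive1_inv_sqrt_speed//.
(* The function is put in the product form whose derivative is [dd]. *)
under [X in derive1 X]eq_fun do rewrite -mulN1r exprS expr2.
rewrite [LHS]derive1E (@derive_val _ _ _ _ _ _ _ dd).
rewrite [derive1 A]derive1_inv_sqrt_speed// -/(A t) /B.
move: (derive1 (derive1 p) t) (derive1 (derive1 q) t) (derive1 p t) (derive1 q t).
by move: (A t) (p t) (q t) => *; ring.
Qed.

(** Here h n = (m y', - m x') with m = h A; [A1], [A2], [m1], [m2] are the first two derivatives of
    A and m, and [p3], [q3] stand for x''', y'''. The third derivatives coming from [A2] cancel
    those of the perturbation. *)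
Lemma curvature_diff_normal {R : realType} (p q r s p3 q3 h h1 h2 A : R) :
  A ^+ 2 * (p ^+ 2 + q ^+ 2) = 1 ->
  let A1 := - ((p * r + q * s) * A ^+ 3) in
  let A2 := 3 * (p * r + q * s) ^+ 2 * A ^+ 5
    - (r ^+ 2 + s ^+ 2 + p * p3 + q * q3) * A ^+ 3 in
  let m := h * A in
  let m1 := h1 * A + h * A1 in
  let m2 := h2 * A + 2 * (h1 * A1) + h * A2 in
  curvature_diff p q r s (m1 * q + m * s) (-1 * (m1 * p + m * r))
    (m2 * q + 2 * (m1 * s) + m * q3) (-1 * (m2 * p + 2 * (m1 * r) + m * p3)) A
  = - ((p * s - r * q) * A ^+ 3) ^+ 2 * h + (p * r + q * s) * A ^+ 4 * h1
    - A ^+ 2 * h2.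
Proof.
move=> Aw A1 A2 m m1 m2.
have Aw0 : A ^+ 2 * (p ^+ 2 + q ^+ 2) - 1 = 0 by rewrite Aw subrr.
pose B := p * r + q * s.
(* [c] is the cofactor: the two sides differ by exactly (A^2 (p^2 + q^2) - 1) c. *)
pose c := 2 * A ^+ 4 * B * h1 - A ^+ 2 * h2
  + h * (A ^+ 4 * (p * p3 + q * q3 - r ^+ 2 - s ^+ 2) - 3 * A ^+ 6 * B ^+ 2).
rewrite -[RHS]addr0 -(mul0r c) -Aw0.
by rewrite /c /m2 /m1 /m /A2 /A1 /B /curvature_diff; ring.
Qed.

(** The defining limit constrains an operator only at smooth periodic maps, so h n must be one of
    them before uniqueness applies to it. *)
Lemma smooth_periodic2_normal {R : realType} (L : R) (g : R -> R * R) (h : R -> R) :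
  smooth_periodic2 L g -> regular g -> smooth_periodic L h ->
  smooth_periodic2 L (fun s => h s *: unit_normal g s).
Proof.
move=> [[sx px] [sy py]] rg [sh ph].
pose x s := (g s).1; pose y s := (g s).2.
have [sx' sy'] := (smooth_derive1 sx, smooth_derive1 sy).
have [px' py'] := (derive1_periodic px, derive1_periodic py).
have sA := @smooth_inv_sqrt R _ rg (smoothD (smooth_sqr sx') (smooth_sqr sy')).
have pn s : unit_normal g (s + L) = unit_normal g s.
  by rewrite /unit_normal px' py'.
have su : smooth (fun t => (h t *: unit_normal g t).1).
  exact: smoothM sh (smoothM sA sy').
have sv : smooth (fun t => (h t *: unit_normal g t).2).
  have -> : (fun t => (h t *: unit_normal g t).2) = (fun t => -1 *
      (h t * ((Num.sqrt (derive1 x t ^+ 2 + derive1 y t ^+ 2))^-1 * derive1 x t))).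
    by apply/funext => t; rewrite mulN1r -!mulrN.
  exact: smooth_scale (smoothM sh (smoothM sA sx')).
have pu : periodic (fun t => (h t *: unit_normal g t).1) L.
  by move=> s; rewrite ph pn.
have pv : periodic (fun t => (h t *: unit_normal g t).2) L.
  by move=> s; rewrite ph pn.
exact: conj (conj su pu) (conj sv pv).
Qed.

Lemma curvature_derivative_normal {R : realType} (x y h : R -> R) (t : R) :
  let gamma := fun t : R => (x t, y t) in
  smooth x -> smooth y -> regular gamma -> smooth h ->
  curvature_derivative gamma (fun s => h s *: unit_normal gamma s) t =
    - curvature gamma t ^+ 2 * h t
    + (derive1 x t * derive1n 2 x t + derive1 y t * derive1n 2 y t)
        / (derive1 x t ^+ 2 + derive1 y t ^+ 2) ^+ 2 * derive1 h t
    - 1 / (derive1 x t ^+ 2 + derive1 y t ^+ 2) * derive1n 2 h t.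
Proof.
move=> gamma sx sy rg sh.
pose A s := (Num.sqrt (derive1 x s ^+ 2 + derive1 y s ^+ 2))^-1.
pose m s := h s * A s.
have [sx' sy'] := (smooth_derive1 sx, smooth_derive1 sy).
have sA : smooth A := @smooth_inv_sqrt R _ rg (smoothD (smooth_sqr sx') (smooth_sqr sy')).
have sm : smooth m := smoothM sh sA.
have uE : (fun s => (h s *: unit_normal gamma s).1) = (fun s => m s * derive1 y s).
  by apply/funext => s; rewrite /m -mulrA.
have vE : (fun s => (h s *: unit_normal gamma s).2)
    = (fun s => -1 * (m s * derive1 x s)).
  by apply/funext => s; rewrite /m mulN1r -mulrA -!mulrN.
have scaleE (f : R -> R) (c : R) : smooth f ->
    derive1 (fun s => c * f s) = (fun s => c * derive1 f s).
  by move=> sf; apply: is_derive_derive1 => s; exact/is_derive_scale/smooth_is_derive.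
have smx : smooth (fun s => m s * derive1 x s) := smoothM sm sx'.
have du : derive1 (fun s => (h s *: unit_normal gamma s).1) t
    = derive1 m t * derive1 y t + m t * derive1n 2 y t.
  by rewrite uE (derive1M_smooth sm sy').
have dv : derive1 (fun s => (h s *: unit_normal gamma s).2) t
    = -1 * (derive1 m t * derive1 x t + m t * derive1n 2 x t).
  by rewrite vE (scaleE _ _ smx) (derive1M_smooth sm sx').
have ddu : derive1n 2 (fun s => (h s *: unit_normal gamma s).1) t
    = derive1n 2 m t * derive1 y t + 2 * (derive1 m t * derive1n 2 y t)
      + m t * derive1n 3 y t.
  by rewrite uE; exact: (derive1n2M_smooth t sm sy').
have ddv : derive1n 2 (fun s => (h s *: unit_normal gamma s).2) t
    = -1 * (derive1n 2 m t * derive1 x t + 2 * (derive1 m t * derive1n 2 x t)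
      + m t * derive1n 3 x t).
  rewrite vE [LHS]/= (scaleE _ _ smx) (scaleE _ _ (smooth_derive1 smx)).
  by congr (-1 * _); exact: (derive1n2M_smooth t sm sx').
have [A0 Aw] := inv_sqrt_sqr (rg t).
have {}Aw : derive1 x t ^+ 2 + derive1 y t ^+ 2 = A t ^- 2 by [].
have wV : (derive1 x t ^+ 2 + derive1 y t ^+ 2)^-1 = A t ^+ 2.
  by rewrite Aw invrK.
rewrite /curvature_derivative du dv ddu ddv.
rewrite /curvature div_powR_3_2; last exact: rg.
(* The quotients of the target become powers of A: 1 / w = A^2 and 1 / w^2 = A^4. *)
rewrite -/(A t) div1r -exprVn wV.
have dm : derive1 m t = derive1 h t * A t + h t * derive1 A t.
  by rewrite (derive1M_smooth sh sA).
have ddm := derive1n2M_smooth t sh sA.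
rewrite dm ddm (derive1_inv_sqrt_speed sx' sy' rg).
rewrite (derive1n2_inv_sqrt_speed t sx' sy' rg) -/(A t).
have AwA : A t ^+ 2 * (derive1 x t ^+ 2 + derive1 y t ^+ 2) = 1.
  by rewrite Aw mulfV// expf_neq0// gt_eqF.
by rewrite curvature_diff_normal// -exprM.
Qed.

(** The existence clause keeps the formula, stated for every derivative [D], from being vacuous. *)
Theorem proposition1 (R : realType) (L : R) (x y h : R -> R) :
  let gamma := fun t : R => (x t, y t) in
  0 < L ->
  smooth_periodic2 L gamma ->
  regular gamma ->
  smooth_periodic L h ->
  (exists D : (R -> R * R) -> R -> R, is_curvature_derivative L gamma D) /\
  (forall D : (R -> R * R) -> R -> R, is_curvature_derivative L gamma D ->
   forall t : R, 0 <= t < L ->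
     D (fun s => h s *: unit_normal gamma s) t =
       - curvature gamma t ^+ 2 * h t
       + (derive1 x t * derive1n 2 x t + derive1 y t * derive1n 2 y t)
           / (derive1 x t ^+ 2 + derive1 y t ^+ 2) ^+ 2 * derive1 h t
       - 1 / (derive1 x t ^+ 2 + derive1 y t ^+ 2) * derive1n 2 h t).
Proof.
move=> gamma L0 sg rg sh; split.
  by exists (curvature_derivative gamma); exact: is_curvature_derivative_exists.
move=> D dD t tL; have dG := is_curvature_derivative_exists L0 sg rg.
rewrite (is_curvature_derivative_unique dD dG (smooth_periodic2_normal sg rg sh) tL).
case: sg sh => [[sx _] [sy _]] [sh _].
exact: (curvature_derivative_normal t sx sy rg sh).
Qed.
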